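(* Let $r\in\mathbb{Q}^\times$, and let $P_r$ be the finite set of primes $p$ with $v_p(r)\ne0$. For a prime $p\notin P_r$ define the locally analytic function $\Psi_{r,p}:\mathbb{Z}_p\to\mathbb{C}_p$ by $\Psi_{r,p}(s)=\langle r\rangle_p^{\,s}\,\Phi_{r,p}\big(\tfrac{s+1}{r}-1\big)$, and for $m\in\mathbb{Z}_{\ge0}$ let $\Psi_{r,\infty}(m)=e^r\int_r^\infty u^me^{-u}\,du$ (path integral of an entire function from $r$ to $+\infty$ along any path eventually on the positive real axis) and $\langle r\rangle_\infty=r$. Let $v,w\in(\{\text{primes}\}\setminus P_r)\cup\{\infty\}$. (i) For all $m\in\mathbb{Z}_{\ge0}$, $\langle r\rangle_v^{-m}\Psi_{r,v}(m)=\langle r\rangle_w^{-m}\Psi_{r,w}(m)$, and this common value is a rational number. (ii) $\Psi_{r,v}(m)=\Psi_{r,w}(m)$ for all $m\in\mathbb{Z}_{\ge0}$ divisible by $\mathrm{lcm}(\ell_v,\ell_w)$, where $\ell_p=p-1$ for a prime $p$ and $\ell_\infty=1$.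
   Context: $\mathbb{C}_p$ is the completion of an algebraic closure of $\mathbb{Q}_p$; $C(\mathbb{Z}_p,\mathbb{C}_p)$ the continuous functions $\mathbb{Z}_p\to\mathbb{C}_p$. $f_r(t)=-r\sum_{k\ge1}(-1)^k\binom{1/r}{k}t^k\in\mathbb{Q}[[t]]$. For $p\notin P_r$, $\phi_{r,p}\in C(\mathbb{Z}_p,\mathbb{C}_p)$ is the unique function with $\sum_{n\ge0}\phi_{r,p}(n)t^n/n!=\exp(f_r(t))$, and $\Phi_{r,p}(s)=S^s(\phi_{r,p})(-1)$ for $s\in\mathbb{Z}_p$, where $S^y(\phi)(x)=\sum_{k\ge0}(-1)^kk!\binom yk\binom xk\phi(x-k)$ and $\binom xk=x(x-1)\cdots(x-k+1)/k!$. The Teichmüller character $\omega_p(x)$ of a unit $x$ of $\mathbb{C}_p$ is the unique root of unity of order prime to $p$ with $|x-\omega_p(x)|<1$, and $\langle x\rangle_p=x/\omega_p(x)$; for $s\in\mathbb{Z}_p$, $\langle r\rangle_p^{s}=\sum_{k\ge0}\binom sk(\langle r\rangle_p-1)^k$. (At the archimedean place $\Psi_{r,\infty}(m)$ as defined agrees with the paper's archimedean function $r^s\Phi_{r,\infty}(\frac{s+1}{r}-1)$ for $r>0$, suitably modified for $r<0$, evaluated at $s=m$.) *)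

(* Defs.v *)
From HB Require Import structures.
From mathcomp Require Import all_boot all_order all_algebra.
From mathcomp Require Import all_classical all_reals all_analysis.
From Stdlib Require Import ClassicalEpsilon.
Set Implicit Arguments. Unset Strict Implicit. Unset Printing Implicit Defensive.
Import Order.TTheory GRing.Theory Num.Theory.
Local Open Scope ring_scope.

Definition binr (F : fieldType) (x : F) (k : nat) : F :=
  (\prod_(i < k) (x - i%:R)) / (k`!)%:R.

Definition vp (r : rat) (p : nat) : int :=
  (logn p `|numq r|)%:Z - (logn p `|denq r|)%:Z.

Definition fr_coef (r : rat) (k : nat) : rat :=
  if k == 0%N then 0 else - r * (-1) ^+ k * binr (r^-1) k.

(* phi_r(n) = n! [t^n] exp(f_r(t)) ; since f_r(0) = 0,
   [t^n] exp(f) = [t^n] sum_{j<=n} F^j / j!  with F the truncation of f at degree n *)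
Definition phin (r : rat) (n : nat) : rat :=
  let F : {poly rat} := \poly_(i < n.+1) fr_coef r i in
  (n`!)%:R * (\sum_(j < n.+1) ((j`!)%:R)^-1 *: F ^+ j)`_n.

(* ---------- p-adic side: an arbitrary complete algebraically closed field
   whose absolute value restricts to the p-adic one on Q (e.g. C_p) ---------- *)

Definition kcvg (K : fieldType) (R : realType) (abs : K -> R) (u : nat -> K) (l : K) :=
  forall e : R, 0 < e -> exists N : nat, forall n, (N <= n)%N -> abs (u n - l) < e.

Definition padic_abs (p : nat) (K : fieldType) (R : realType) (abs : K -> R) : Prop :=
  [/\ (forall x, 0 <= abs x),
      (forall x, abs x = 0 <-> x = 0),
      (forall x y, abs (x * y) = abs x * abs y),
      (forall x y, abs (x + y) <= Num.max (abs x) (abs y)) /\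
      (forall n : nat, (0 < n)%N -> abs (n%:R) = (p%:R ^- logn p n : R))
    &
      (forall u : nat -> K,
        (forall e : R, 0 < e -> exists N : nat, forall n m, (N <= n)%N -> (N <= m)%N ->
            abs (u n - u m) < e) ->
        exists l, kcvg abs u l) ].

Section Padic.
Variables (p : nat) (K : fieldType) (R : realType) (abs : K -> R).

(* sum of a convergent series (arbitrary value if divergent) *)
Definition ksum (u : nat -> K) : K :=
  epsilon (inhabits 0) (fun l => kcvg abs (fun n => \sum_(k < n) u k) l).

Definition inZp (x : K) : Prop :=
  forall e : R, 0 < e -> exists n : nat, abs (x - n%:R) < e.

Definition cont_on_Zp (f : K -> K) : Prop :=
  forall x, inZp x -> forall e : R, 0 < e -> exists2 d : R, 0 < d &
    forall y, inZp y -> abs (x - y) < d -> abs (f x - f y) < e.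

Definition phi_p (r : rat) : K -> K :=
  epsilon (inhabits (fun _ => 0))
    (fun f => cont_on_Zp f /\ forall n : nat, f n%:R = ratr (phin r n)).

Definition Sop (f : K -> K) (y x : K) : K :=
  ksum (fun k => (-1) ^+ k * (k`!)%:R * binr y k * binr x k * f (x - k%:R)).

Definition Phi_p (r : rat) (s : K) : K := Sop (phi_p r) s (-1).

Definition teich (x : K) : K :=
  epsilon (inhabits 0) (fun w => (exists n : nat, [/\ (0 < n)%N, coprime n p & w ^+ n = 1])
                                  /\ abs (x - w) < 1).

Definition brk (x : K) : K := x / teich x.

Definition kpow (a s : K) : K := ksum (fun k => binr s k * (a - 1) ^+ k).

Definition Psi_p (r : rat) (s : K) : K :=
  kpow (brk (ratr r)) s * Phi_p r ((s + 1) / ratr r - 1).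

End Padic.

Local Open Scope ereal_scope.
Definition Psi_inf (R : realType) (r : rat) (m : nat) : \bar R :=
  (expR (ratr r))%:E *
  \int[lebesgue_measure]_(u in `[(ratr r : R), +oo[%classic) (u ^+ m * expR (- u))%:E.
Local Close Scope ereal_scope.

(* ---------- places: None = infinity, Some p = the prime p ---------- *)
Definition good_place (r : rat) (v : option nat) : Prop :=
  match v with None => True | Some p => prime p /\ vp r p = 0 end.

Definition ell (v : option nat) : nat :=
  match v with None => 1%N | Some p => p.-1 end.

Definition psi_is (r : rat) (v : option nat) (m : nat) (q : rat) : Prop :=
  match v with
  | None => forall R : realType, Psi_inf R r m = (ratr q : R)%:E
  | Some p => forall (K : closedFieldType) (R : realType) (abs : K -> R),
      padic_abs p abs -> Psi_p p abs r m%:R = ratr q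
  end.

Definition npsi_is (r : rat) (v : option nat) (m : nat) (q : rat) : Prop :=
  match v with
  | None => forall R : realType,
      (((ratr r : R) ^- m)%:E * Psi_inf R r m)%E = (ratr q : R)%:E
  | Some p => forall (K : closedFieldType) (R : realType) (abs : K -> R),
      padic_abs p abs ->
      brk p abs (ratr r) ^- m * Psi_p p abs r m%:R = ratr q
  end.

(* Main.v *)
(** With [f = r (1 - (1 - t)^(1/r))] one has
    [d/dt ((1-t)^y e^f) = -y (1-t)^(y-1) e^f + (1-t)^(y+1/r-1) e^f].  Read on
    coefficients this is an identity between the [S^y(phi)] at natural numbers;
    extended by continuity to [x = -1] it says
    [1 = -y Phi(y-1) + Phi(y+1/r-1)], because [S^y(phi)(0) = 1].  For [y = m/r]
    this is the recurrence that integration by parts gives for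
    [r^(-m) e^r int_r^oo u^m e^(-u) du], so both sides are the same rational
    number.  The continuous extension of [phi] exists by Mahler's criterion:
    [exp f = e^t exp g] with [g = O(t^2)] integral, and then [n! [t^n] exp g]
    tends to 0.  Finally [omega(r)^(p-1) = 1] gives (ii). *)

From HB Require Import structures.
From mathcomp Require Import all_boot all_order all_algebra.
From mathcomp Require Import all_classical all_reals all_analysis.
From mathcomp Require Import measurable_realfun cyclic ring zify.
From Stdlib Require Import ClassicalEpsilon.
(* [Defs] comes last because its [inZp] must shadow that of [zmodp]. *)
Require Import Defs.
Set Implicit Arguments. Unset Strict Implicit. Unset Printing Implicit Defensive.
Import Order.TTheory GRing.Theory Num.Theory.
Import numFieldNormedType.Exports.
Local Open Scope ring_scope.

(** * Formal power series as coefficient sequences *)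

Section PowerSeries.
Variable F : fieldType.
Implicit Types (a b c f g : nat -> F) (p q : {poly F}).

Definition conv a b n : F := \sum_(k < n.+1) a k * b (n - k)%N.

Definition sderiv a n : F := n.+1%:R * a n.+1.

(** The coefficients of [exp f] when [f 0 = 0]. The truncations copy those of [phin], which is
    thereby an instance by conversion. *)
Definition sexp f n : F :=
  (\sum_(j < n.+1) ((j`!)%:R)^-1 *: (\poly_(i < n.+1) f i) ^+ j)`_n.

Lemma coefM_eq p p' q q' n :
  (forall i, (i <= n)%N -> p`_i = p'`_i) ->
  (forall i, (i <= n)%N -> q`_i = q'`_i) ->
  (p * q)`_n = (p' * q')`_n.
Proof.
move=> pp qq; rewrite !coefM; apply: eq_bigr => i _.
by rewrite pp ?qq ?leq_subr // -ltnS.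
Qed.

Lemma coefX_eq p p' j n :
  (forall i, (i <= n)%N -> p`_i = p'`_i) -> (p ^+ j)`_n = (p' ^+ j)`_n.
Proof.
elim: j n => [|j IH] n pp; first by rewrite !expr0.
rewrite !exprS; apply: coefM_eq => // i lin; apply: IH => k lki.
by apply: pp; apply: leq_trans lin.
Qed.

(** [X^d] divides [p], hence [X^(d j)] divides [p ^+ j]. *)
Lemma coefX_low p d j n :
  (forall i, (i < d)%N -> p`_i = 0) -> (n < d * j)%N -> (p ^+ j)`_n = 0.
Proof.
move=> p0 nj; rewrite -(poly_take_drop d p) (_ : take_poly d p = 0) ?add0r.
  by rewrite exprMn -exprM coefMXn nj.
by apply/polyP => i; rewrite coef_take_poly coef0; case: ifP => // /p0.
Qed.

(** Passing to truncated polynomials imports the ring laws and the Leibniz rule from [{poly F}]. *)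
Lemma convE N a b n : (n < N)%N ->
  conv a b n = (\poly_(i < N) a i * \poly_(i < N) b i)`_n.
Proof.
move=> nN; rewrite coefM; apply: eq_bigr => i _; rewrite !coef_poly.
have iN: (i < N)%N by apply: leq_ltn_trans nN; rewrite -ltnS.
by rewrite iN (leq_ltn_trans _ nN) ?leq_subr.
Qed.

Lemma eq_conv a a' b b' n :
  (forall i, (i <= n)%N -> a i = a' i) -> (forall i, (i <= n)%N -> b i = b' i) ->
  conv a b n = conv a' b' n.
Proof.
by move=> aa bb; apply: eq_bigr => i _; rewrite aa ?bb ?leq_subr // -ltnS.
Qed.

Lemma convA a b c : conv a (conv b c) =1 conv (conv a b) c.
Proof.
move=> n; rewrite !(@convE n.+1) //.
set A := \poly_(i < _) a i; set B := \poly_(i < n.+1) b i.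
set C := \poly_(i < _) c i.
transitivity ((A * (B * C))`_n).
  by apply: coefM_eq => // i lin; rewrite coef_poly ltnS lin (@convE n.+1).
by rewrite mulrA; apply: coefM_eq => // i lin; rewrite coef_poly ltnS lin (@convE n.+1).
Qed.

Lemma convC a b : conv a b =1 conv b a.
Proof. by move=> n; rewrite !(@convE n.+1) // mulrC. Qed.

Lemma convDl a b c n : conv (fun k => a k + b k) c n = conv a c n + conv b c n.
Proof. by rewrite -big_split; apply: eq_bigr => i _ /=; rewrite mulrDl. Qed.

Lemma convZl (x : F) a b n : conv (fun k => x * a k) b n = x * conv a b n.
Proof. by rewrite mulr_sumr; apply: eq_bigr => i _; rewrite mulrA. Qed.

Lemma conv1l a n : conv (fun k => (k == 0%N)%:R) a n = a n.
Proof.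
rewrite /conv big_ord_recl mul1r subn0 big1 ?addr0 // => i _.
by rewrite mul0r.
Qed.

Lemma conv0 a b : conv a b 0 = a 0%N * b 0%N.
Proof. by rewrite /conv big_ord_recl big_ord0 addr0. Qed.

Lemma sderiv_conv a b n :
  sderiv (conv a b) n = conv (sderiv a) b n + conv a (sderiv b) n.
Proof.
rewrite /sderiv mulr_natl (@convE n.+2) // -coef_deriv derivM coefD.
rewrite !(@convE n.+1) //.
by congr (_ + _); apply: coefM_eq => i lin;
  rewrite ?coef_deriv !coef_poly ?ltnS ?lin ?(leq_trans lin) ?mulr_natl.
Qed.

Hypothesis char0 : forall n, n.+1%:R != 0 :> F.

Lemma fact_neq0 n : (n`!)%:R != 0 :> F.
Proof. by have := fact_gt0 n; case: n`! => // k _; exact: char0. Qed.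

(** In [a' = g a] the coefficient of index [n.+1] is fixed by those up to [n], after division by
    [n.+1]. *)
Lemma series_ode_uniq g a b :
  a 0%N = b 0%N -> sderiv a =1 conv g a -> sderiv b =1 conv g b -> a =1 b.
Proof.
move=> ab0 Ha Hb n; elim/ltn_ind: n => -[//|n] IH.
apply: (mulfI (char0 n)); rewrite -[LHS]/(sderiv a n) -[RHS]/(sderiv b n).
by rewrite Ha Hb; apply: eq_conv => // i lin; apply: IH.
Qed.

(** As [f 0 = 0], the power [f^j] starts in degree [j]: neither the terms with [j > n] nor the
    coefficients of [f] beyond [n] reach degree [n]. *)
Lemma sexpE f n M N : f 0%N = 0 -> (n <= M)%N -> (n <= N)%N ->
  sexp f n = (\sum_(j < M.+1) ((j`!)%:R)^-1 *: (\poly_(i < N.+1) f i) ^+ j)`_n.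
Proof.
move=> f0 nM nN; rewrite /sexp !coef_sum.
rewrite (big_ord_widen_cond M.+1 predT
  (fun j => ((j`!)%:R^-1 *: (\poly_(i < n.+1) f i) ^+ j)`_n)) //.
rewrite big_mkcond; apply: eq_bigr => j _ /=; rewrite !coefZ.
case: ltnP => nj.
  congr (_ * _); apply: coefX_eq => i lin.
  by rewrite !coef_poly !ltnS lin (leq_trans lin).
rewrite (@coefX_low _ 1) ?mulr0 ?mul1n // => -[|//] _.
by rewrite coef_poly f0.
Qed.

Lemma sexp0 f : sexp f 0 = 1.
Proof. by rewrite /sexp big_ord_recl big_ord0 addr0 expr0 fact0 invr1 scale1r coef1. Qed.

Lemma sderiv_sexp f : f 0%N = 0 -> sderiv (sexp f) =1 conv (sderiv f) (sexp f).
Proof.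
move=> f0 n; rewrite /sderiv (@sexpE _ _ n.+1 n.+1) // mulr_natl -coef_deriv.
set G := \poly_(i < _) f i.
rewrite big_ord_recl expr0 derivD derivZ derivC scaler0 add0r raddf_sum.
have -> : \sum_(i < n.+1) (((lift ord0 i)`!)%:R^-1 *: G ^+ lift ord0 i)^`()
   = G^`() * \sum_(i < n.+1) ((i`!)%:R^-1 *: G ^+ i).
  rewrite mulr_sumr; apply: eq_bigr => i _.
  rewrite lift0 derivZ deriv_exp /= -scaler_nat scalerA factS natrM.
  rewrite invfM mulrAC mulVf ?char0 ?mul1r //.
  by rewrite -scalerAr.
rewrite coefM; apply: eq_bigr => i _.
have lin : (i <= n)%N by rewrite -ltnS.
rewrite coef_deriv coef_poly !ltnS lin mulr_natl; congr (_ * _).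
by rewrite (@sexpE _ _ n n.+1) ?leq_subr // leqW ?leq_subr.
Qed.

(** Both sides solve [h' = f' h] with [h(0) = 1]. *)
Lemma sexp_shift f g : f 0%N = 0 -> g 0%N = 0 ->
  (forall k, f k = (k == 1%N)%:R + g k) ->
  sexp f =1 conv (fun k => (k`!)%:R^-1) (sexp g).
Proof.
move=> f0 g0 fg; apply: (@series_ode_uniq (sderiv f)).
- by rewrite conv0 !sexp0 fact0 invr1 mulr1.
- exact: sderiv_sexp.
move=> n; rewrite sderiv_conv.
have -> : sderiv f = (fun k => (k == 0%N)%:R + sderiv g k).
  by apply/funext => k; rewrite /sderiv fg mulrDr eqSS; case: k => [|k]; rewrite ?mulr0 ?mul1r.
rewrite convDl conv1l; congr (_ + _).
  apply: eq_conv => // i _; rewrite /sderiv factS natrM invfM mulrA mulfV ?mul1r //.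
transitivity (conv (fun k => (k`!)%:R^-1) (conv (sderiv g) (sexp g)) n).
  by apply: eq_conv => // i _; rewrite sderiv_sexp.
by rewrite convA [RHS]convA; apply: eq_conv => // i _; rewrite convC.
Qed.

(** * Binomial series *)

(** The coefficients of [(1 - t)^y]. *)
Definition bser (y : F) k : F := (-1) ^+ k * binr y k.

Lemma binrS (y : F) k : binr y k.+1 = binr y k * (y - k%:R) / k.+1%:R.
Proof.
rewrite /binr big_ord_recr /= factS natrM invfM; ring.
Qed.

Lemma binr0 (y : F) : binr y 0 = 1.
Proof. by rewrite /binr big_ord0 fact0 divr1. Qed.

Lemma binr_absorb (y : F) k : binr y k.+1 = y / k.+1%:R * binr (y - 1) k.
Proof.
elim: k => [|k IH]; first by rewrite binrS !binr0 subr0 mulr1 mul1r.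
rewrite binrS IH (binrS (y - 1)) -![k.+1%:R]natr1; ring.
Qed.

Lemma binr_nat n k : binr (n%:R : F) k = 'C(n, k)%:R.
Proof.
elim: k => [|k IH]; first by rewrite binr0 bin0.
rewrite binrS IH; apply: (mulIf (char0 k)); rewrite divfK //.
rewrite -natrM mulnC mul_bin_left natrM mulrC.
case: (leqP k n) => [kn|nk]; first by rewrite natrB.
by rewrite bin_small ?mulr0.
Qed.

Lemma sderiv_bser y n : sderiv (bser y) n = - y * bser (y - 1) n.
Proof.
rewrite /sderiv /bser binr_absorb exprS; move: n.+1%:R (char0 n) => z z0.
by field.
Qed.

(** Induction on the degree: [bS] is [(1 - t) b' = - x b] on coefficients, and in the derivative of
    the product the factors [i - y] and [n - i - z] add up to [n - (y + z)]. *)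
Lemma conv_bser y z : conv (bser y) (bser z) =1 bser (y + z).
Proof.
have bS x n : n.+1%:R * bser x n.+1 = (n%:R - x) * bser x n.
  rewrite /bser binrS exprS; move: n.+1%:R (char0 n) => u u0; by field.
elim=> [|n IH]; first by rewrite conv0 /bser !binr0 expr0 !mulr1.
apply: (mulfI (char0 n)); rewrite bS -IH -[LHS]/(sderiv _ _) sderiv_conv.
rewrite /conv -big_split /= mulr_sumr; apply: eq_bigr => i _.
have lin : (i <= n)%N by rewrite -ltnS.
by rewrite /sderiv !bS natrB //; ring.
Qed.

(* Coefficients of [x (1 - (1 - t)^(1/x))]; at [F = rat] this is [fr_coef x]. *)
Definition root_ser (x : F) k : F :=
  if k == 0%N then 0 else - x * (-1) ^+ k * binr x^-1 k.

Lemma sderiv_root_ser x : x != 0 -> sderiv (root_ser x) =1 bser (x^-1 - 1).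
Proof.
move=> x0 n; rewrite /sderiv /root_ser /= /bser binr_absorb exprS.
move: n.+1%:R (char0 n) => z z0; by field; rewrite z0 x0.
Qed.

Lemma root_ser1 x : x != 0 -> root_ser x 1 = 1.
Proof.
move=> x0; rewrite /root_ser /= binrS binr0 subr0 divr1 expr1 mul1r.
by rewrite mulrN1 opprK mulfV.
Qed.

(** The series [f = root_ser x] has [f' = (1 - t)^(1/x - 1)], and exponents add under multiplication
    by [(1 - t)^y]. *)
Lemma sderiv_bser_sexp x y n : x != 0 ->
  sderiv (conv (bser y) (sexp (root_ser x))) n =
  - y * conv (bser (y - 1)) (sexp (root_ser x)) n +
  conv (bser (y + x^-1 - 1)) (sexp (root_ser x)) n.
Proof.
move=> x0; rewrite sderiv_conv; congr (_ + _).
  by rewrite -convZl; apply: eq_conv => // i _; rewrite sderiv_bser.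
transitivity (conv (bser y) (conv (bser (x^-1 - 1)) (sexp (root_ser x))) n).
  apply: eq_conv => // i _; rewrite sderiv_sexp //.
  by apply: eq_conv => // j _; rewrite sderiv_root_ser.
rewrite convA; apply: eq_conv => // i _.
by rewrite conv_bser addrA.
Qed.

Definition phi_seq (x : F) n : F := (n`!)%:R * sexp (root_ser x) n.

(** Since [n! / (n-k)! = k! C(n,k)], the right-hand side, which is [S^y(phi)(n)], is read off a
    Cauchy product. *)
Lemma fact_conv_bser x y n :
  (n`!)%:R * conv (bser y) (sexp (root_ser x)) n =
  \sum_(k < n.+1) (-1) ^+ k * (k`!)%:R * binr y k * binr n%:R k * phi_seq x (n - k).
Proof.
rewrite mulr_sumr; apply: eq_bigr => k _; have lkn : (k <= n)%N by rewrite -ltnS.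
rewrite /phi_seq binr_nat -(bin_fact lkn) !natrM /bser; ring.
Qed.

(** [(n+1)! [t^(n+1)]] of a series is [n! [t^n]] of its derivative. *)
Lemma phi_seq_functional x y n : x != 0 ->
  let S y n := \sum_(k < n.+1)
    (-1) ^+ k * (k`!)%:R * binr y k * binr n%:R k * phi_seq x (n - k) in
  S y n.+1 = - y * S (y - 1) n + S (y + x^-1 - 1) n.
Proof.
move=> x0 /=; rewrite -!fact_conv_bser factS mulnC natrM -mulrA.
rewrite -[_.+1%:R * _]/(sderiv _ _) sderiv_bser_sexp //; ring.
Qed.

(** The Mahler expansion: multiplication by [e^t] acts on the numbers [n! [t^n]] as the binomial
    transform. It splits off because the linear coefficient of [root_ser x] is 1. *)
Lemma phi_seq_mahler x n : x != 0 ->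
  phi_seq x n = \sum_(k < n.+1)
    binr n%:R k * ((k`!)%:R * sexp (fun i => if (i < 2)%N then 0 else root_ser x i) k).
Proof.
move=> x0; rewrite /phi_seq (@sexp_shift _ (fun i => if (i < 2)%N then 0 else root_ser x i)) //.
  rewrite convC mulr_sumr; apply: eq_bigr => k _.
  have lkn : (k <= n)%N by rewrite -ltnS.
  rewrite binr_nat -(bin_fact lkn) !natrM.
  by move: ((n - k)`!)%:R (fact_neq0 (n - k)) => z z0; field.
by case=> [|[|k]]; rewrite /= ?addr0 ?add0r ?root_ser1.
Qed.

End PowerSeries.

(** * Ultrametric estimates *)

Section PadicAbs.
Variables (p : nat) (K : fieldType) (R : realType) (abs : K -> R).
Hypotheses (p_pr : prime p) (abs_p : padic_abs p abs).
Implicit Types (x y : K) (f g : K -> K) (u : nat -> K).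

Lemma abs_ge0 x : 0 <= abs x. Proof. by case: abs_p. Qed.

Lemma abs_eq0 x : (abs x == 0) = (x == 0).
Proof. by case: abs_p => _ h _ _ _; apply/eqP/eqP => /h. Qed.

Lemma absM x y : abs (x * y) = abs x * abs y.
Proof. by case: abs_p. Qed.

Lemma abs_nat n : (0 < n)%N -> abs n%:R = p%:R ^- logn p n.
Proof. by case: abs_p => _ _ _ [_ h] _; exact: h. Qed.

Lemma absD_le x y (e : R) : abs x <= e -> abs y <= e -> abs (x + y) <= e.
Proof.
case: abs_p => _ _ _ [h _] _ hx hy; apply: le_trans (h x y) _.
by rewrite ge_max hx hy.
Qed.

Lemma absD_lt x y (e : R) : abs x < e -> abs y < e -> abs (x + y) < e.
Proof.
case: abs_p => _ _ _ [h _] _ hx hy; apply: le_lt_trans (h x y) _.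
by rewrite gt_max hx hy.
Qed.

Lemma abs0 : abs 0 = 0. Proof. by apply/eqP; rewrite abs_eq0. Qed.

Lemma abs1 : abs 1 = 1.
Proof. by rewrite -[X in abs X](mulr1n 1) abs_nat // logn1 expr0 invr1. Qed.

Lemma absX x n : abs (x ^+ n) = abs x ^+ n.
Proof. by elim: n => [|n IH]; rewrite ?expr0 ?abs1 // !exprS absM IH. Qed.

Lemma absN x : abs (- x) = abs x.
Proof.
suff h : abs (-1) = 1 by rewrite -mulN1r absM h mul1r.
apply/eqP; rewrite -(@pexpr_eq1 R _ 2) ?abs_ge0 //.
by rewrite -absX expr2 mulrNN mulr1 abs1.
Qed.

Lemma absBC x y : abs (x - y) = abs (y - x).
Proof. by rewrite -absN opprB. Qed.

Lemma absV x : abs x^-1 = (abs x)^-1.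
Proof.
have [->|x0] := eqVneq x 0; first by rewrite invr0 abs0 invr0.
apply: (mulfI (x := abs x)); first by rewrite abs_eq0.
by rewrite -absM !mulfV ?abs1 ?abs_eq0.
Qed.

Lemma absB_lt_trans x y z (e : R) : abs (x - y) < e -> abs (y - z) < e -> abs (x - z) < e.
Proof. by move=> h1 h2; rewrite -(subrKA y); exact: absD_lt. Qed.

Lemma abs_nat_le1 n : abs n%:R <= 1.
Proof.
case: n => [|n]; first by rewrite abs0.
rewrite abs_nat // invf_le1 ?exprn_gt0 ?ltr0n ?prime_gt0 //.
by rewrite exprn_ege1 // ler1n prime_gt0.
Qed.

Lemma abs_mul_le (a b : R) x y : abs x <= a -> abs y <= b -> abs (x * y) <= a * b.
Proof. by move=> *; rewrite absM ler_pM ?abs_ge0. Qed.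

Lemma abs_mul_le1 x y (e : R) : abs x <= 1 -> abs y <= e -> abs (x * y) <= e.
Proof. by move=> hx hy; rewrite -[e]mul1r; exact: abs_mul_le. Qed.

Lemma abs_mul_lt1 x y (e : R) : abs x <= 1 -> abs y < e -> abs (x * y) < e.
Proof.
move=> hx hy; rewrite absM; apply: le_lt_trans hy.
by rewrite ler_piMl ?abs_ge0.
Qed.

Lemma abs_sum_le (I : Type) (s : seq I) (P : pred I) (h : I -> K) (e : R) :
  0 <= e -> (forall i, P i -> abs (h i) <= e) -> abs (\sum_(i <- s | P i) h i) <= e.
Proof.
move=> e0 he; elim/big_rec: _ => [|i x Pi hx]; first by rewrite abs0.
by apply: absD_le => //; exact: he.
Qed.

Lemma abs_sign n : abs ((-1) ^+ n) = 1.
Proof. by rewrite absX absN abs1 expr1n. Qed.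

Lemma char0_padic n : n.+1%:R != 0 :> K.
Proof.
by rewrite -abs_eq0 abs_nat // invr_eq0 expf_neq0 // pnatr_eq0 -lt0n prime_gt0.
Qed.

Lemma abs_coprime n : coprime n p -> abs n%:R = 1.
Proof.
move=> cn; have n0 : (0 < n)%N.
  by case: n cn => //; rewrite /coprime gcd0n => /eqP p1; move: p_pr; rewrite p1.
rewrite abs_nat // (_ : logn p n = 0%N) ?expr0 ?invr1 //.
by apply: logn_coprime; rewrite coprime_sym.
Qed.

Lemma abs_p_lt1 : abs p%:R < 1.
Proof.
rewrite abs_nat ?prime_gt0 // logn_prime // eqxx expr1.
by rewrite invf_lt1 ?ltr0n ?ltr1n ?prime_gt1 ?prime_gt0.
Qed.

Lemma abs_dvd_le m n : (m %| n)%N -> abs n%:R <= abs m%:R.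
Proof.
by case/dvdnP => k ->; rewrite natrM; apply: abs_mul_le1 => //; exact: abs_nat_le1.
Qed.

Lemma abs_expp_small (e : R) : 0 < e -> exists k, abs (p ^ k)%:R < e.
Proof.
move=> e0; exists (Num.bound e^-1).
rewrite abs_nat ?expn_gt0 ?prime_gt0 // pfactorK //.
rewrite -[ltRHS]invrK ltf_pV2 ?posrE ?invr_gt0 ?exprn_gt0 ?ltr0n ?prime_gt0 //.
apply: lt_trans (archi_boundP _) _; first by rewrite invr_ge0 ltW.
rewrite -natrX ltr_nat. exact: ltn_expl (prime_gt1 p_pr).
Qed.

Lemma abs_fact_le m n : (m <= n)%N -> abs n`!%:R <= abs m`!%:R.
Proof. by move=> mn; apply: abs_dvd_le; rewrite -(bin_fact mn) mulnCA dvdn_mulr. Qed.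

(** For [n >= p^k] the number [p^k] divides [n!]. *)
Lemma abs_fact_small (e : R) : 0 < e -> exists N, forall n, (N <= n)%N -> abs n`!%:R < e.
Proof.
case/abs_expp_small => k hk; exists (p ^ k)%N => n hn; apply: le_lt_trans hk.
by apply: abs_dvd_le; apply: dvdn_fact; rewrite expn_gt0 prime_gt0.
Qed.

(** * The closure of the natural numbers *)

Lemma inZp_nat n : inZp abs n%:R.
Proof. by move=> e e0; exists n; rewrite subrr abs0. Qed.

Lemma inZp_le1 x : inZp abs x -> abs x <= 1.
Proof.
case/(_ 1 ltr01) => n hn; rewrite -(subrK n%:R x).
by apply: absD_le; [exact: ltW|exact: abs_nat_le1].
Qed.

Lemma inZpD x y : inZp abs x -> inZp abs y -> inZp abs (x + y).
Proof.
move=> hx hy e e0; have [n hn] := hx _ e0; have [m hm] := hy _ e0.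
by exists (n + m)%N; rewrite natrD opprD addrACA; exact: absD_lt.
Qed.

Lemma inZpM x y : inZp abs x -> inZp abs y -> inZp abs (x * y).
Proof.
move=> hx hy e e0; have [n hn] := hx _ e0; have [m hm] := hy _ e0.
exists (n * m)%N; rewrite natrM.
have -> : x * y - n%:R * m%:R = y * (x - n%:R) + n%:R * (y - m%:R) by ring.
by apply: absD_lt; apply: abs_mul_lt1 => //; [exact: inZp_le1|exact: abs_nat_le1].
Qed.

Lemma inZpN1 : inZp abs (-1).
Proof.
(* [p^k - 1] differs from [-1] by [p^k]. *)
move=> e /abs_expp_small[k hk]; exists (p ^ k).-1.
by rewrite -opprD nat1r prednK ?absN // expn_gt0 prime_gt0.
Qed.

Lemma inZpN x : inZp abs x -> inZp abs (- x).
Proof. by move=> hx; rewrite -mulN1r; apply: inZpM => //; exact: inZpN1. Qed.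

Lemma inZpB x y : inZp abs x -> inZp abs y -> inZp abs (x - y).
Proof. by move=> hx hy; apply: inZpD => //; exact: inZpN. Qed.

Lemma inZpV_nat d : coprime d p -> inZp abs (d%:R^-1).
Proof.
move=> cd e /abs_expp_small[k hk].
have d0 : d%:R != 0 :> K by rewrite -abs_eq0 abs_coprime ?oner_eq0.
(* By Euler's theorem this is an inverse of [d] modulo [p^k]. *)
exists (d ^ (totient (p ^ k)).-1)%N.
have -> : d%:R^-1 - (d ^ (totient (p ^ k)).-1)%:R
  = - (d%:R^-1 * (d ^ totient (p ^ k) - 1)%:R) :> K.
  rewrite natrB ?expn_gt0 ?lt0n; last first.
    by apply/orP; left; apply: contra d0 => /eqP ->.
  rewrite mulrBr mulr1 opprB; congr (_ - _).
  rewrite -[in RHS](@prednK (totient (p ^ k))) ?totient_gt0 ?expn_gt0 ?prime_gt0 //.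
  by rewrite expnS natrM mulKf.
rewrite absN absM absV abs_coprime // invr1 mul1r; apply: le_lt_trans hk.
apply: abs_dvd_le; rewrite -eqn_mod_dvd; last first.
  by rewrite expn_gt0 lt0n; apply/orP; left; apply: contra d0 => /eqP ->.
by apply/eqP; apply: Euler_exp_totient; exact: coprimeXr.
Qed.

Lemma inZp_int (z : int) : inZp abs z%:~R.
Proof.
by case: z => n; [exact: inZp_nat|rewrite NegzE mulrNz; apply: inZpN; exact: inZp_nat].
Qed.

Lemma abs_int (z : int) : abs z%:~R = abs `|z|%N%:R.
Proof. by case: z => n //; rewrite NegzE mulrNz absN. Qed.

Lemma inZpV_int (z : int) : coprime `|z| p -> inZp abs z%:~R^-1.
Proof.
case: z => n cn; first exact: inZpV_nat.
by rewrite NegzE mulrNz invrN; apply: inZpN; exact: inZpV_nat.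
Qed.

(** * Convergence *)

Lemma abs_partial_sum_le u (B : R) N n m : 0 <= B ->
  (forall k, (N <= k)%N -> abs (u k) <= B) -> (N <= n)%N -> (N <= m)%N ->
  abs (\sum_(k < n) u k - \sum_(k < m) u k) <= B.
Proof.
move=> B0 hB; wlog mn : n m / (m <= n)%N => [hw|] hn hm.
  by have [|/ltnW] := leqP m n => ?; [|rewrite absBC]; exact: hw.
rewrite -(subnKC mn) big_split_ord /= addrAC subrr add0r.
by apply: abs_sum_le => // i _; apply: hB; apply: (leq_trans hm); rewrite leq_addr.
Qed.

(** By the ultrametric inequality, terms tending to 0 make the partial sums Cauchy; [e / 2] only
    turns a bound [<=] into [<]. *)
Lemma ksum_cvg u : (forall e : R, 0 < e -> exists N, forall k, (N <= k)%N -> abs (u k) < e) ->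
  kcvg abs (fun n => \sum_(k < n) u k) (ksum abs u).
Proof.
move=> hu; apply: (epsilon_spec (inhabits 0)).
case: abs_p => _ _ _ _; apply => e e0.
have e20 : 0 < e / 2 by rewrite divr_gt0.
have [N hN] := hu _ e20; exists N => n m hn hm.
apply: (@le_lt_trans _ _ (e / 2)); last by rewrite ltr_pdivrMr // ltr_pMr // ltr1n.
by apply: (@abs_partial_sum_le _ _ N) => //; [exact: ltW|move=> k /hN/ltW].
Qed.

(** Were the distance above [B], a late partial sum would be closer than that to the limit and
    within [B] of the [N]-th one, against the ultrametric inequality. *)
Lemma ksum_tail u (B : R) N : 0 <= B ->
  (forall e : R, 0 < e -> exists N, forall k, (N <= k)%N -> abs (u k) < e) ->
  (forall k, (N <= k)%N -> abs (u k) <= B) ->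
  abs (ksum abs u - \sum_(k < N) u k) <= B.
Proof.
move=> B0 /ksum_cvg hu hB; rewrite leNgt; apply/negP => hlt.
have [M hM] := hu _ (le_lt_trans B0 hlt).
set n := maxn M N; have := hM n (leq_maxl _ _).
rewrite absBC => h1.
have h2 : abs (\sum_(k < n) u k - \sum_(k < N) u k) <= B.
  by apply: (@abs_partial_sum_le _ _ N) => //; exact: leq_maxr.
have := absB_lt_trans h1 (le_lt_trans h2 hlt).
by rewrite ltxx.
Qed.

Lemma ksum_finite u N : (forall k, (N <= k)%N -> u k = 0) ->
  ksum abs u = \sum_(k < N) u k.
Proof.
move=> hu; apply/eqP; rewrite -subr_eq0 -abs_eq0 eq_le abs_ge0 andbT.
apply: ksum_tail => // [e e0|k /hu ->]; last by rewrite abs0.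
by exists N => k /hu ->; rewrite abs0.
Qed.

(** * Continuous functions on [Zp] *)

Lemma cont_cst (c : K) : cont_on_Zp abs (fun=> c).
Proof. by move=> x _ e e0; exists 1 => // y _ _; rewrite subrr abs0. Qed.

Lemma cont_id : cont_on_Zp abs id.
Proof. by move=> x _ e e0; exists e. Qed.

Lemma contD f g : cont_on_Zp abs f -> cont_on_Zp abs g -> cont_on_Zp abs (fun x => f x + g x).
Proof.
move=> hf hg x hx e e0; have [d d0 hd] := hf x hx e e0; have [c c0 hc] := hg x hx e e0.
exists (Num.min d c) => [|y hy]; first by rewrite lt_min d0 c0.
rewrite lt_min => /andP[h1 h2]; rewrite opprD addrACA.
by apply: absD_lt; [exact: hd|exact: hc].
Qed.

Lemma contM f g : cont_on_Zp abs f -> cont_on_Zp abs g -> cont_on_Zp abs (fun x => f x * g x).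
Proof.
move=> hf hg x hx e e0.
have pos z : 0 < 1 + abs z by rewrite (@lt_le_trans _ _ 1) // lerDl abs_ge0.
have bnd z w : abs w < e / (1 + abs z) -> abs (z * w) < e.
  rewrite ltr_pdivlMr // => h; rewrite absM mulrC; apply: le_lt_trans h.
  by rewrite ler_wpM2l ?abs_ge0 // lerDr.
(* The bounds 1 and [e] serve for the cross term [(f x - f y) * (g x - g y)]; [1 + abs _] avoids a
   zero denominator. *)
have [|d d0 hd] := hf x hx (Num.min 1 (e / (1 + abs (g x)))).
  by rewrite lt_min ltr01 divr_gt0.
have [|c c0 hc] := hg x hx (Num.min e (e / (1 + abs (f x)))).
  by rewrite lt_min e0 divr_gt0.
exists (Num.min d c) => [|y hy]; first by rewrite lt_min d0 c0.
rewrite lt_min => /andP[/(hd _ hy) h1 /(hc _ hy) h2].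
move: h1 h2; rewrite !lt_min => /andP[h1 h1'] /andP[h2 h2'].
have -> : f x * g x - f y * g y =
  f x * (g x - g y) + g x * (f x - f y) + (- (f x - f y)) * (g x - g y) by ring.
apply: absD_lt; first by apply: absD_lt; exact: bnd.
by apply: abs_mul_lt1 => //; rewrite absN ltW.
Qed.

Lemma cont_sum N (h : nat -> K -> K) : (forall k, cont_on_Zp abs (h k)) ->
  cont_on_Zp abs (fun x => \sum_(k < N) h k x).
Proof.
move=> hh; elim: N => [|N IH].
  by under eq_fun do rewrite big_ord0; exact: cont_cst.
by under eq_fun do rewrite big_ord_recr; exact: contD.
Qed.

Lemma cont_prod N (h : nat -> K -> K) : (forall k, cont_on_Zp abs (h k)) ->
  cont_on_Zp abs (fun x => \prod_(k < N) h k x).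
Proof.
move=> hh; elim: N => [|N IH].
  by under eq_fun do rewrite big_ord0; exact: cont_cst.
by under eq_fun do rewrite big_ord_recr; exact: contM.
Qed.

Lemma cont_shift f (c : K) : inZp abs c -> cont_on_Zp abs f ->
  cont_on_Zp abs (fun x => f (x + c)).
Proof.
move=> hc hf x hx e e0; have [d d0 hd] := hf _ (inZpD hx hc) e e0.
exists d => // y hy hxy; apply: hd; first exact: inZpD.
by rewrite (_ : x + c - (y + c) = x - y) //; ring.
Qed.

Lemma cont_binr k : cont_on_Zp abs (fun x => binr x k).
Proof.
apply: contM; last exact: cont_cst.
by apply: (@cont_prod k (fun i x => x - i%:R)) => i; apply: contD; [exact: cont_id|exact: cont_cst].
Qed.

(** If [B < |f x|], a natural [n] close to [x] has [|f x - f n| < |f x|] and [|f n| <= B < |f x|],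
    which is impossible. *)
Lemma cont_le f (B : R) : cont_on_Zp abs f -> (forall n, abs (f n%:R) <= B) ->
  forall x, inZp abs x -> abs (f x) <= B.
Proof.
move=> hf hB x hx; rewrite leNgt; apply/negP => hlt.
have e0 : 0 < abs (f x) by apply: le_lt_trans hlt; apply: le_trans (hB 0%N); exact: abs_ge0.
have [d d0 hd] := hf x hx _ e0; have [n hn] := hx _ d0.
have h1 := hd _ (inZp_nat n) hn.
have := absD_lt h1 (le_lt_trans (hB n) hlt).
by rewrite subrK ltxx.
Qed.

Lemma cont_eq0 f : cont_on_Zp abs f -> (forall n, f n%:R = 0) ->
  forall x, inZp abs x -> f x = 0.
Proof.
move=> hf f0 x hx; apply/eqP; rewrite -abs_eq0 eq_le abs_ge0 andbT.
by apply: (cont_le hf) => // n; rewrite f0 abs0.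
Qed.

(** At natural numbers the values are integers, and the bound passes to the closure. *)
Lemma abs_binr_le1 x k : inZp abs x -> abs (binr x k) <= 1.
Proof.
apply: (cont_le (cont_binr k)) => n.
by rewrite (binr_nat char0_padic) abs_nat_le1.
Qed.

(** Uniform convergence: the [B k] control the tails at all points at once, so one finite sum
    approximates the series everywhere on [Zp]. *)
Lemma cont_ksum (h : nat -> K -> K) (B : nat -> R) :
  (forall k, cont_on_Zp abs (h k)) ->
  (forall k x, inZp abs x -> abs (h k x) <= B k) ->
  (forall e : R, 0 < e -> exists N, forall k, (N <= k)%N -> B k < e) ->
  cont_on_Zp abs (fun x => ksum abs (fun k => h k x)).
Proof.
move=> hc hB B0 x hx e e0.
have e20 : 0 < e / 2 by rewrite divr_gt0.
have e2e : e / 2 < e by rewrite ltr_pdivrMr // ltr_pMr // ltr1n.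
have [N hN] := B0 _ e20.
have tail y : inZp abs y -> abs (ksum abs (h^~ y) - \sum_(k < N) h k y) < e.
  move=> hy; apply: le_lt_trans e2e; apply: ksum_tail; first exact: ltW.
    move=> a /B0[M hM]; exists M => k /hM; apply: le_lt_trans; exact: hB.
  by move=> k /hN/ltW; apply: le_trans; exact: hB.
have [d d0 hd] := @cont_sum N h hc x hx e e0.
exists d => // y hy hxy; apply: absB_lt_trans (tail x hx) _.
by apply: absB_lt_trans (hd y hy hxy) _; rewrite absBC; exact: tail.
Qed.

End PadicAbs.

(** * The embedding of [rat] into a field of characteristic 0 *)

Section RatrChar0.
Variable K : fieldType.
Hypothesis char0 : forall n, n.+1%:R != 0 :> K.

Lemma intr_neq0 (z : int) : z != 0 -> z%:~R != 0 :> K.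
Proof.
case: z => [[//|n]|n] _; first exact: char0.
by rewrite NegzE mulrNz oppr_eq0 char0.
Qed.

(** [ratr] may be computed from an unreduced fraction. The morphism laws below follow by writing
    differences and products as single fractions. *)
Lemma ratr_divz (a b : int) : b != 0 -> ratr (a%:~R / b%:~R) = a%:~R / b%:~R :> K.
Proof.
move=> b0; rewrite /ratr; set q := a%:~R / b%:~R.
have d0 : denq q != 0 by exact: denq_neq0.
have h : numq q * b = a * denq q.
  apply: (@intr_inj rat); rewrite !intrM.
  have := divq_num_den q; rewrite {3}/q => /eqP.
  by rewrite eqr_div ?intr_eq0 // => /eqP.
apply/eqP; rewrite eqr_div ?intr_neq0 //.
by rewrite -!intrM h.
Qed.

Lemma ratr_zmod_morphism_char0 : zmod_morphism (ratr : rat -> K).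
Proof.
move=> x y.
have -> : x - y = (numq x * denq y - numq y * denq x)%:~R / (denq x * denq y)%:~R.
  rewrite -{1}(divq_num_den x) -{1}(divq_num_den y).
  have : (denq x)%:~R != 0 :> rat by rewrite intr_eq0 denq_neq0.
  have : (denq y)%:~R != 0 :> rat by rewrite intr_eq0 denq_neq0.
  by move=> h1 h2; rewrite intrB !intrM; field; rewrite h1 h2.
rewrite ratr_divz ?mulf_neq0 ?denq_neq0 // /ratr.
have := intr_neq0 (denq_neq0 x); have := intr_neq0 (denq_neq0 y).
by move=> h1 h2; rewrite intrB !intrM; field; rewrite h1 h2.
Qed.

Lemma ratr_monoid_morphism_char0 : monoid_morphism (ratr : rat -> K).
Proof.
split; first by rewrite -[1](mulr1n 1) ratr_nat.
move=> x y.
have -> : x * y = (numq x * numq y)%:~R / (denq x * denq y)%:~R.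
  rewrite -{1}(divq_num_den x) -{1}(divq_num_den y).
  by rewrite !intrM invfM mulrACA.
rewrite ratr_divz ?mulf_neq0 ?denq_neq0 // /ratr.
by rewrite !intrM invfM mulrACA.
Qed.

Definition ratr_char0 : {rmorphism rat -> K} :=
  let M := GRing.isZmodMorphism.Build rat K ratr ratr_zmod_morphism_char0 in
  let N := GRing.isMonoidMorphism.Build rat K ratr ratr_monoid_morphism_char0 in
  HB.pack_for {rmorphism rat -> K} (ratr : rat -> K) M N.

End RatrChar0.

(** * Compatibility of the series with field morphisms *)

Section Transport.
Variables (F K : fieldType) (h : {rmorphism F -> K}).

Lemma rmorph_binr (y : F) k : h (binr y k) = binr (h y) k.
Proof.
rewrite /binr fmorph_div rmorph_nat rmorph_prod; congr (_ / _).
by apply: eq_bigr => i _; rewrite rmorphB rmorph_nat.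
Qed.

Lemma rmorph_sexp (f : nat -> F) n : h (sexp f n) = sexp (h \o f) n.
Proof.
rewrite /sexp -coef_map rmorph_sum; congr (nth 0 (polyseq _) n); apply: eq_bigr => j _ /=.
rewrite map_polyZ rmorphXn fmorphV rmorph_nat; congr (_ *: _ ^+ _).
by apply/polyP => i; rewrite coef_map !coef_poly; case: ifP => //=; rewrite rmorph0.
Qed.

Lemma rmorph_root_ser (x : F) k : h (root_ser x k) = root_ser (h x) k.
Proof.
rewrite /root_ser; case: eqP => _; first by rewrite rmorph0.
by rewrite rmorphM rmorph_binr fmorphV rmorphM rmorphN rmorphXn rmorphN1.
Qed.

Lemma rmorph_phi_seq (x : F) n : h (phi_seq x n) = phi_seq (h x) n.
Proof.
rewrite /phi_seq rmorphM rmorph_nat rmorph_sexp; congr (_ * _).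
by congr (sexp _ n); apply/funext => k /=; rewrite rmorph_root_ser.
Qed.

End Transport.

(** * The interpolation of [phi_seq] and its functional equation *)

Section PhiPadic.
Variables (p : nat) (K : fieldType) (R : realType) (abs : K -> R).
Hypotheses (p_pr : prime p) (abs_p : padic_abs p abs).

Let char0 := char0_padic p_pr abs_p.

Lemma abs_coefX_le1 (P : {poly K}) j n : (forall i, abs P`_i <= 1) -> abs (P ^+ j)`_n <= 1.
Proof.
move=> hP; elim: j n => [|j IH] n.
  by rewrite expr0 coef1; case: eqP; rewrite ?(abs1 abs_p) ?(abs0 abs_p).
rewrite exprS coefM; apply: (abs_sum_le abs_p) => // i _.
by apply: (abs_mul_le1 abs_p).
Qed.

(* Only the [j <= n/2] contribute to [t^n] in [sum_j g^j / j!], and [n!/j!] is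
   a multiple of [(n-j)!]. *)
Lemma abs_fact_sexp_le (g : nat -> K) n : (forall i, (i < 2)%N -> g i = 0) ->
  (forall i, abs (g i) <= 1) -> abs (n`!%:R * sexp g n) <= abs (n./2)`!%:R.
Proof.
move=> g0 g1; rewrite /sexp coef_sum mulr_sumr.
apply: (abs_sum_le abs_p) => [|j _]; first exact: (abs_ge0 abs_p).
set P := \poly_(i < _) g i.
have P1 i : abs P`_i <= 1 by rewrite coef_poly; case: ifP => // _; rewrite (abs0 abs_p).
rewrite coefZ; have [nj|jn] := ltnP n (2 * j).
  rewrite (@coefX_low _ _ 2) ?mulr0 ?(abs0 abs_p) ?(abs_ge0 abs_p) // => i i2.
  by rewrite coef_poly g0 //; case: ifP.
have ljn : (j <= n)%N by lia.
rewrite -(bin_fact ljn) mulnCA natrM mulrACA divff ?(fact_neq0 char0) // mul1r.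
rewrite mulrC; apply: (abs_mul_le1 abs_p); first exact: abs_coefX_le1.
rewrite natrM; apply: (abs_mul_le1 abs_p); first exact: (abs_nat_le1 p_pr abs_p).
by apply: (abs_fact_le p_pr abs_p); lia.
Qed.

Variable x : K.
Hypotheses (x_unit : abs x = 1) (xV_Zp : inZp abs x^-1).

Let x_neq0 : x != 0.
Proof. by rewrite -(abs_eq0 abs_p) x_unit oner_eq0. Qed.

Let g i := if (i < 2)%N then 0 else root_ser x i.
(** The Mahler coefficients of [phi_seq x], by [phi_seq_mahler]; [g] is [root_ser x] minus [t]. *)
Let a k := k`!%:R * sexp g k.

(** As [1/x] lies in [Zp], its binomial coefficients are integral; as moreover [x] is a unit, [g] is
    integral. *)
Let abs_a k : abs (a k) <= abs (k./2)`!%:R.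
Proof.
apply: abs_fact_sexp_le => i; rewrite /g; first by move=> ->.
case: ifP => _; first by rewrite (abs0 abs_p).
rewrite /root_ser; case: eqP => _; first by rewrite (abs0 abs_p).
apply: (abs_mul_le1 abs_p); last exact: (abs_binr_le1 p_pr abs_p).
by rewrite (absM abs_p) (absN abs_p) x_unit (abs_sign abs_p) mul1r.
Qed.

Let half_fact_small (e : R) : 0 < e ->
  exists N, forall k, (N <= k)%N -> abs (k./2)`!%:R < e.
Proof.
case/(abs_fact_small p_pr abs_p) => N hN; exists N.*2 => k hk.
by apply: hN; rewrite -(doubleK N) half_leq.
Qed.

Let a_term k y : inZp abs y -> abs (binr y k * a k) <= abs (k./2)`!%:R.
Proof.
by move=> hy; apply: (abs_mul_le1 abs_p) => //; exact: (abs_binr_le1 p_pr abs_p).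
Qed.

(** The Mahler series converges uniformly because its coefficients tend to 0, and at [n] it stops
    after the term of index [n]. *)
Lemma phi_seq_interpolation : exists f : K -> K,
  cont_on_Zp abs f /\ forall n : nat, f n%:R = phi_seq x n.
Proof.
exists (fun y => ksum abs (fun k => binr y k * a k)); split.
  apply: (cont_ksum abs_p) a_term half_fact_small => k.
  apply: (contM abs_p); first exact: (cont_binr abs_p).
  exact: (cont_cst abs_p).
move=> n; rewrite (ksum_finite abs_p (N := n.+1)); first by rewrite (phi_seq_mahler char0).
by move=> k nk; rewrite (binr_nat char0) bin_small ?mul0r.
Qed.

Lemma abs_phi_seq_le1 n : abs (phi_seq x n) <= 1.
Proof.
rewrite (phi_seq_mahler char0) //; apply: (abs_sum_le abs_p) => // k _.
apply: le_trans (a_term _ (inZp_nat abs_p n)) _.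
exact: (abs_nat_le1 p_pr abs_p).
Qed.

Variable f : K -> K.
Hypotheses (f_cont : cont_on_Zp abs f) (f_nat : forall n : nat, f n%:R = phi_seq x n).

Let f_le1 y : inZp abs y -> abs (f y) <= 1.
Proof. by apply: (cont_le abs_p) => // n; rewrite f_nat abs_phi_seq_le1. Qed.

(** The factor [k!] tends to 0 and all the others are integral, so the series converges uniformly in
    [z]. *)
Lemma cont_Sop y : inZp abs y -> cont_on_Zp abs (fun z => Sop abs f y z).
Proof.
move=> hy; apply: (cont_ksum abs_p (B := fun k => abs k`!%:R)).
- move=> k; apply: (contM abs_p).
    by apply: (contM abs_p); [exact: (cont_cst abs_p)|exact: (cont_binr abs_p)].
  apply: (cont_shift abs_p) => //; apply: (inZpN p_pr abs_p); exact: (inZp_nat abs_p).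
- move=> k z hz; rewrite mulrC; apply: (abs_mul_le1 abs_p).
    by apply: f_le1; apply: (inZpB p_pr abs_p) => //; exact: (inZp_nat abs_p).
  rewrite mulrC; apply: (abs_mul_le1 abs_p); first exact: (abs_binr_le1 p_pr abs_p).
  rewrite mulrC; apply: (abs_mul_le1 abs_p); first exact: (abs_binr_le1 p_pr abs_p).
  by rewrite (absM abs_p) (abs_sign abs_p) mul1r.
- exact: (abs_fact_small p_pr abs_p).
Qed.

Lemma Sop_nat y n : Sop abs f y n%:R = \sum_(k < n.+1)
  (-1) ^+ k * (k`!)%:R * binr y k * binr n%:R k * phi_seq x (n - k).
Proof.
rewrite /Sop (ksum_finite abs_p (N := n.+1)) => [|k nk].
  by apply: eq_bigr => k _; rewrite -f_nat natrB // -ltnS.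
by rewrite (binr_nat char0) bin_small // mulr0 mul0r.
Qed.

(* The identity [phi_seq_functional] extended by continuity from [n] to [-1],
   where its left-hand side becomes [Sop abs f y 0 = 1]. *)
Lemma Sop_functional y : inZp abs y ->
  1 = - y * Sop abs f (y - 1) (-1) + Sop abs f (y + x^-1 - 1) (-1).
Proof.
move=> hy.
have h1 : inZp abs 1 by rewrite -[1](mulr1n 1); exact: (inZp_nat abs_p).
have hN1 := inZpN1 p_pr abs_p.
have hy1 : inZp abs (y - 1) by exact: (inZpB p_pr abs_p).
have hyx : inZp abs (y + x^-1 - 1).
  by apply: (inZpB p_pr abs_p) => //; exact: (inZpD abs_p).
pose H z := Sop abs f y (z + 1) + (y * Sop abs f (y - 1) z + (-1) * Sop abs f (y + x^-1 - 1) z).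
have H_cont : cont_on_Zp abs H.
  apply: (contD abs_p); first by apply: (cont_shift abs_p) => //; exact: cont_Sop.
  by apply: (contD abs_p); apply: (contM abs_p); first [exact: (cont_cst abs_p)|exact: cont_Sop].
have H_nat n : H n%:R = 0.
  rewrite /H natr1 !Sop_nat.
  by have /= -> := phi_seq_functional char0 y n x_neq0; ring.
have := cont_eq0 abs_p H_cont H_nat hN1.
have S0 : Sop abs f y 0 = 1.
  rewrite -[LHS]/(Sop abs f y 0%:R) Sop_nat big_ord1 (binr_nat char0) bin0 binr0.
  by rewrite expr0 fact0 !mul1r subnn /phi_seq sexp0 fact0 mulr1.
rewrite /H addNr S0 => h.
by apply/eqP; rewrite -subr_eq0 -h; apply/eqP; ring.
Qed.

End PhiPadic.

(** * The archimedean place *)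

(* [e^u Gamma(m+1, u)], the upper incomplete Gamma function. *)
Fixpoint incgamma_poly (F : fieldType) (m : nat) (u : F) : F :=
  if m is k.+1 then u ^+ k.+1 + k.+1%:R * incgamma_poly k u else 1.

Section Archimedean.
Local Open Scope classical_set_scope.
Variable R : realType.

(** Minus the upper incomplete Gamma function, an antiderivative of [u^m e^(-u)]. *)
Let A m (u : R) := - expR (- u) * incgamma_poly m u.

Lemma is_derive_incgamma m (x : R) : is_derive x 1 (A m) (x ^+ m * expR (- x)).
Proof.
have dE : is_derive x 1 (fun u : R => expR (- u)) (- expR (- x)).
  by apply: (is_derive_eq (is_derive1_comp _ _)); rewrite /GRing.scale /=; ring.
elim: m => [|m IH]; rewrite /A /=.
  by apply: is_derive_eq; rewrite scaler0 add0r scale1r mul1r opprK.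
(* The recurrence of integration by parts. *)
have -> : (fun u : R => - expR (- u) * (u ^+ m.+1 + m.+1%:R * incgamma_poly m u)) =
  - (fun u => expR (- u)) * id ^+ m.+1 + m.+1%:R \*: A m.
  by apply/funext => u; rewrite /A !fctE /= mulrDr; congr (_ + _); exact: mulrCA.
apply: (is_derive_eq (is_deriveD (is_deriveM (is_deriveN dE)
  (is_deriveX m.+1 (is_derive_id x 1))) (is_deriveZ m.+1%:R IH))).
rewrite !fctE /GRing.scale /= exprS; ring.
Qed.

Lemma continuous_incgamma m : continuous (A m).
Proof.
by move=> x; apply/differentiable_continuous/derivable1_diffP; case: (is_derive_incgamma m x).
Qed.

(** [expR x >= x^(m+1) / (m+1)!] bounds the product by [(m+1)! / x], which is at most [e] once
    [x >= (m+1)! / e]. *)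
Lemma cvg_expr_expRN m : (x : R) ^+ m * expR (- x) @[x --> +oo] --> (0 : R).
Proof.
apply/cvgrPdist_le => e e0; near=> x.
have x0 : 0 < x by near: x; apply: nbhs_pinfty_gt; exact: num_real.
rewrite sub0r normrN ger0_norm ?mulr_ge0 ?exprn_ge0 ?expR_ge0 ?(ltW x0) //.
rewrite expRN ler_pdivrMr ?expR_gt0 //.
have := expR_ge1Dxn m (ltW x0); have f0 : (0 : R) < m.+1`!%:R by rewrite ltr0n fact_gt0.
move=> h; have {}h : x ^+ m.+1 / m.+1`!%:R <= expR x by apply: le_trans h; rewrite lerDr.
apply: le_trans (_ : e * (x ^+ m.+1 / m.+1`!%:R) <= _); last by rewrite ler_wpM2l // ltW.
have : m.+1`!%:R / e <= x by near: x; apply: nbhs_pinfty_ge; exact: num_real.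
rewrite ler_pdivrMr // => h2.
rewrite mulrA ler_pdivlMr // exprS mulrA [e * x]mulrC [leRHS]mulrC.
by rewrite ler_wpM2l // exprn_ge0 // ltW.
Unshelve. all: by end_near. Qed.

Lemma cvg_incgamma m : A m x @[x --> +oo] --> (0 : R).
Proof.
elim: m => [|m IH].
  rewrite /A /=; under eq_fun do rewrite mulr1.
  by rewrite -[0 : R]oppr0; apply: cvgN; exact: cvgr_expR.
have -> : A m.+1 = (fun u => - (u ^+ m.+1 * expR (- u)) + m.+1%:R * A m u).
  by apply/funext => u; rewrite /A /=; ring.
have := cvgD (cvgN (cvg_expr_expRN m.+1)) (cvgM (cvg_cst (m.+1%:R : R)) IH).
by rewrite mulr0 oppr0 addr0; apply; exact: proper_pinfty_nbhs.
Qed.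

Let f m (x : R) := x ^+ m * expR (- x).

Lemma continuous_expr_expRN m : continuous (f m).
Proof.
move=> x; apply: cvgM; first exact: exprn_continuous.
by apply: continuous_comp; [exact: opp_continuous|exact: continuous_expR].
Qed.

Lemma derive1_incgamma m : (A m)^`() =1 f m.
Proof. by move=> x; rewrite derive1E; case: (is_derive_incgamma m x). Qed.

Local Open Scope ereal_scope.

Lemma integral_incgamma_ge0 m (a : R) : (0 <= a)%R ->
  \int[lebesgue_measure]_(u in `[a, +oo[) (f m u)%:E = (- A m a)%:E.
Proof.
move=> a0; rewrite (@ge0_continuous_FTC2y R (f m) (A m) a 0%R).
- by rewrite sub0e EFinN.
- by move=> x ax; rewrite mulr_ge0 ?expR_ge0 // exprn_ge0 // (le_trans a0).
- by apply: continuous_subspaceT; exact: continuous_expr_expRN.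
- exact: cvg_incgamma.
- by move=> x _; case: (is_derive_incgamma m x).
- by apply: cvg_at_right_filter; exact: continuous_incgamma.
- by move=> x _; exact: derive1_incgamma.
Qed.

Lemma integral_incgamma m (a : R) :
  \int[lebesgue_measure]_(u in `[a, +oo[) (u ^+ m * expR (- u))%:E =
  (expR (- a) * incgamma_poly m a)%:E.
Proof.
have -> : (expR (- a) * incgamma_poly m a = - A m a)%R by rewrite /A; ring.
have [a0|a0] := leP 0%R a; first exact: integral_incgamma_ge0.
have mf (B : set (measurableTypeR R)) : measurable_fun B (f m).
  apply: measurable_funTS.
  by apply: continuous_measurable_fun; exact: continuous_expr_expRN.
(* For [a < 0] the integrand may be negative on [[a, 0]]: this compact piece gets the ordinary
   fundamental theorem of calculus. The rest is open at 0, and adding that endpoint gives the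
   nonnegative case. *)
rewrite (@itv_bndbnd_setU _ _ _ (BRight 0%R)) ?bnd_simp ?ltW //.
rewrite integral_setU //=.
- rewrite (@continuous_FTC2 R (f m) (A m)) //.
  + rewrite integral_itv_obnd_cbnd; last by (apply/measurable_EFinP; exact: mf).
    rewrite integral_incgamma_ge0 // -[(- (A m a)%:E)%E]EFinN -!EFinD.
    by congr (_%:E); ring.
  + by apply: continuous_subspaceT; exact: continuous_expr_expRN.
  + split.
    * by move=> x _; case: (is_derive_incgamma m x).
    * by apply: cvg_at_right_filter; exact: continuous_incgamma.
    * by apply: cvg_at_left_filter; exact: continuous_incgamma.
  + by move=> x _; exact: derive1_incgamma.
- by apply/measurable_EFinP; exact: mf.
- apply/disj_setPS => x /=; rewrite !in_itv /= andbT => -[/andP[_ h1] h2].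
  by move: (lt_le_trans h2 h1); rewrite ltxx.
Qed.

Lemma Psi_infE (r : rat) m : Psi_inf R r m = (incgamma_poly m (ratr r : R))%:E.
Proof.
rewrite /Psi_inf integral_incgamma -EFinM mulrA -expRD subrr expR0 mul1r //.
Qed.

End Archimedean.

(** * The Teichmuller character *)

Lemma coprime_predn p : prime p -> coprime p.-1 p.
Proof. by move=> pp; rewrite -{2}(prednK (prime_gt0 pp)) coprimenS. Qed.

Section Teichmuller.
Variables (p : nat) (K : closedFieldType) (R : realType) (abs : K -> R).
Hypotheses (p_pr : prime p) (abs_p : padic_abs p abs).

Lemma abs_subX_lt1 (x y : K) n : abs x <= 1 -> abs y <= 1 -> abs (x - y) < 1 ->
  abs (x ^+ n - y ^+ n) < 1.
Proof.
move=> hx hy hxy; rewrite subrXX mulrC; apply: (abs_mul_lt1 abs_p) => //.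
apply: (abs_sum_le abs_p) => // i _; apply: (abs_mul_le1 abs_p);
  by rewrite (absX abs_p) exprn_ile1 ?(abs_ge0 abs_p).
Qed.

Lemma abs_unity_root (w : K) n : (0 < n)%N -> w ^+ n = 1 -> abs w = 1.
Proof.
move=> n0 wn; apply/eqP; rewrite -(@pexpr_eq1 R _ n) ?(abs_ge0 abs_p) //.
by rewrite -(absX abs_p) wn (abs1 abs_p).
Qed.

(* [z^n - 1 = (z - 1)(1 + z + ... + z^(n-1))], where the second factor is
   congruent to the unit [n]. *)
Lemma unity_root_near1 (z : K) n : coprime n p -> z ^+ n = 1 -> abs (z - 1) < 1 -> z = 1.
Proof.
move=> cn zn z1; have n1 := abs_coprime p_pr abs_p cn.
have [n0|n0] := posnP n.
  by move: n1; rewrite n0 (abs0 abs_p) => /eqP; rewrite eq_sym oner_eq0.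
have az := abs_unity_root n0 zn.
have : (z - 1) * \sum_(i < n) z ^+ i == 0 by rewrite -subrX1 zn subrr.
rewrite mulf_eq0 subr_eq0 => /orP[/eqP //|/eqP s0].
suff : (1 : R) < 1 by rewrite ltxx.
rewrite -{1}n1 -(absN abs_p) -[- _]add0r -[0 in X in X < _]s0.
have -> : n%:R = \sum_(i < n) 1 :> K by rewrite sumr_const card_ord.
rewrite -sumrB; elim/big_ind: _ => [|x y|i _]; first by rewrite (abs0 abs_p).
  exact: (absD_lt abs_p).
by rewrite -[X in _ - X](expr1n _ i); apply: abs_subX_lt1; rewrite ?az ?(abs1 abs_p).
Qed.

(** [x] is congruent to a natural [n], prime to [p] because [|x| = 1], and Fermat's little theorem
    applies to [n]. *)
Lemma fermat_Zp (x : K) : inZp abs x -> abs x = 1 -> abs (x ^+ p.-1 - 1) < 1.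
Proof.
move=> hx x1; have [n hn] := hx _ ltr01.
have np : coprime n p.
  rewrite coprime_sym prime_coprime //; apply/negP => pn.
  have : abs (x - n%:R + n%:R) < 1.
    apply: (absD_lt abs_p) => //; apply: le_lt_trans (abs_dvd_le p_pr abs_p pn) _.
    exact: (abs_p_lt1 p_pr abs_p).
  by rewrite subrK x1 ltxx.
apply: (absB_lt_trans abs_p (y := n%:R ^+ p.-1)).
  by apply: abs_subX_lt1; rewrite ?x1 ?(abs_nat_le1 p_pr abs_p).
have n0 : (0 < n)%N.
  by case: (n) np => //; rewrite /coprime gcd0n => /eqP p1; move: p_pr; rewrite p1.
rewrite -natrX -[1](mulr1n 1) -natrB ?expn_gt0 ?n0 //.
apply: (@le_lt_trans _ _ (abs p%:R)).
  apply: (abs_dvd_le p_pr abs_p); rewrite -eqn_mod_dvd ?expn_gt0 ?n0 //.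
  by have := Euler_exp_totient np; rewrite totient_prime // => /eqP.
exact: (abs_p_lt1 p_pr abs_p).
Qed.

(** [x^(p-1) - 1] is the product of the [x - w] over the [(p-1)]-th roots of unity [w]; a product of
    factors of absolute value at least 1 could not be smaller than 1. *)
Lemma teich_exists (x : K) : abs (x ^+ p.-1 - 1) < 1 ->
  exists w : K, w ^+ p.-1 = 1 /\ abs (x - w) < 1.
Proof.
move=> hx; have p1 : (0 < p.-1)%N by rewrite -subn1 subn_gt0 prime_gt1.
have [s hs] := closed_field_poly_normal ('X^(p.-1) - 1 : {poly K}).
have mon : 'X^(p.-1) - 1 \is @monic K by rewrite -[1]/(1%:P) monicXnsubC.
rewrite (monicP mon) scale1r in hs.
have [|hall] := boolP (has (fun w => abs (x - w) < 1) s).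
  case/hasP => w ws hw; exists w; split=> //.
  have : root ('X^(p.-1) - 1) w by rewrite hs root_prod_XsubC.
  by rewrite rootE !hornerE subr_eq0 => /eqP.
suff : 1 <= abs (x ^+ p.-1 - 1) by rewrite leNgt hx.
have -> : x ^+ p.-1 - 1 = \prod_(w <- s) (x - w).
  have := congr1 (fun P => P.[x]) hs; rewrite !hornerE => ->.
  by rewrite horner_prod; apply: eq_bigr => w _; rewrite !hornerE.
elim: s hall {hs} => [|w s IH] /=; first by rewrite big_nil (abs1 abs_p).
rewrite negb_or -leNgt big_cons (absM abs_p) => /andP[h1 /IH h2].
by rewrite -[1]mulr1 ler_pM.
Qed.

Lemma teich_spec (x : K) : inZp abs x -> abs x = 1 ->
  (exists n : nat, [/\ (0 < n)%N, coprime n p & teich p abs x ^+ n = 1]) /\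
  abs (x - teich p abs x) < 1.
Proof.
move=> hx x1; apply: (epsilon_spec (inhabits (0 : K)) (fun w =>
  (exists n : nat, [/\ (0 < n)%N, coprime n p & w ^+ n = 1]) /\ abs (x - w) < 1)).
have [w [w1 hw]] := teich_exists (fermat_Zp hx x1).
exists w; split=> //; exists p.-1; split=> //; last exact: coprime_predn.
by rewrite -subn1 subn_gt0 prime_gt1.
Qed.

(** The choice in [teich] only prescribes an order prime to [p]. Its quotient by the root [w0] of
    [teich_exists] is a root of unity of order prime to [p] and near 1, hence 1. *)
Lemma teichX (x : K) : inZp abs x -> abs x = 1 -> teich p abs x ^+ p.-1 = 1.
Proof.
move=> hx x1; have [[n [n0 np wn]] hw] := teich_spec hx x1.
have [w0 [w01 hw0]] := teich_exists (fermat_Zp hx x1).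
have aw0 : abs w0 = 1.
  by apply: abs_unity_root w01; rewrite -subn1 subn_gt0 prime_gt1.
have nz : w0 != 0 by rewrite -(abs_eq0 abs_p) aw0 oner_eq0.
move: wn hw; set w := teich p abs x => wn hw.
suff : w / w0 = 1 by move=> /divr1_eq ->.
apply: (@unity_root_near1 _ (n * p.-1)).
- by rewrite coprimeMl np coprime_predn.
- by rewrite expr_div_n exprM wn expr1n mul1r mulnC exprM w01 expr1n invr1.
- rewrite -(divff nz) -mulrBl (absM abs_p) (absV abs_p) aw0 invr1 mulr1.
  by apply: (absB_lt_trans abs_p) hw0; rewrite (absBC abs_p).
Qed.

Lemma teich_neq0 (x : K) : inZp abs x -> abs x = 1 -> teich p abs x != 0.
Proof.
move=> hx x1; have [[n [n0 _ wn]] _] := teich_spec hx x1.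
by rewrite -(abs_eq0 abs_p) (abs_unity_root n0 wn) oner_eq0.
Qed.

Lemma brkX (x : K) m : inZp abs x -> abs x = 1 -> (p.-1 %| m)%N ->
  brk p abs x ^+ m = x ^+ m.
Proof.
move=> hx x1 /dvdnP[k ->].
by rewrite /brk expr_div_n mulnC (exprM (teich _ _ _)) teichX // expr1n divr1.
Qed.

Lemma brk_neq0 (x : K) : inZp abs x -> abs x = 1 -> brk p abs x != 0.
Proof.
move=> hx x1; rewrite mulf_neq0 ?invr_eq0 ?teich_neq0 //.
by rewrite -(abs_eq0 abs_p) x1 oner_eq0.
Qed.

Lemma kpow_nat (a : K) m : kpow abs a m%:R = a ^+ m.
Proof.
have char0 := char0_padic p_pr abs_p.
rewrite /kpow (ksum_finite abs_p (N := m.+1)) => [|k mk]; last first.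
  by rewrite (binr_nat char0) bin_small ?mul0r.
rewrite -{2}(subrKC 1 a) addrC exprDn; apply: eq_bigr => k _.
by rewrite (binr_nat char0) expr1n mul1r mulr_natl.
Qed.

End Teichmuller.

(** * Values at natural numbers *)

Section PhiValues.
Variables (p : nat) (K : closedFieldType) (R : realType) (abs : K -> R).
Hypotheses (p_pr : prime p) (abs_p : padic_abs p abs).
Variable r : rat.
Hypotheses (r_neq0 : r != 0) (vp_r : vp r p = 0).

Let char0 := char0_padic p_pr abs_p.
Let iota := ratr_char0 char0.

(** [vp r p = 0] equates the valuations of numerator and denominator; coprimality then makes both
    vanish. *)
Lemma vp_eq0_coprime : coprime `|numq r| p /\ coprime `|denq r| p.
Proof.
have := coprime_num_den r.
have n0 : (0 < `|numq r|)%N by rewrite absz_gt0 numq_eq0.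
have d0 : (0 < `|denq r|)%N by rewrite absz_gt0 denq_neq0.
have hlog : logn p `|numq r| = logn p `|denq r|.
  by have /eqP := vp_r; rewrite subr_eq0 eqz_nat => /eqP.
rewrite ![coprime _ p]coprime_sym !(prime_coprime _ p_pr) => cnd.
have dvd_log n : (0 < n)%N -> (p %| n)%N = (0 < logn p n)%N.
  by move=> n_gt0; rewrite logn_gt0 mem_primes p_pr n_gt0.
rewrite !dvd_log // hlog -dvd_log //; suff : ~~ (p %| `|denq r|)%N by [].
apply/negP => pd; have pn : (p %| `|numq r|)%N by rewrite dvd_log // hlog -dvd_log.
have : (p %| gcdn `|numq r| `|denq r|)%N by rewrite dvdn_gcd pn.
by rewrite (eqP cnd) dvdn1 => /eqP p1; move: p_pr; rewrite p1.
Qed.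

Lemma inZp_ratr : inZp abs (ratr r).
Proof.
have [_ cd] := vp_eq0_coprime.
by apply: (inZpM p_pr abs_p); [exact: (inZp_int p_pr abs_p)|exact: (inZpV_int p_pr abs_p)].
Qed.

Lemma inZp_ratrV : inZp abs (ratr r)^-1.
Proof.
have [cn _] := vp_eq0_coprime; rewrite /ratr invfM invrK mulrC.
by apply: (inZpM p_pr abs_p); [exact: (inZp_int p_pr abs_p)|exact: (inZpV_int p_pr abs_p)].
Qed.

Lemma abs_ratr : abs (ratr r) = 1.
Proof.
have [cn cd] := vp_eq0_coprime.
by rewrite (absM abs_p) (absV abs_p) !(abs_int abs_p) !(abs_coprime p_pr abs_p) // divr1.
Qed.

Lemma phi_p_spec : cont_on_Zp abs (phi_p abs r) /\
  forall n : nat, phi_p abs r n%:R = phi_seq (ratr r : K) n.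
Proof.
(* [phin r] is [phi_seq r] by conversion, so transport along [ratr] suffices. *)
have phiE n : ratr (phin r n) = phi_seq (ratr r : K) n.
  exact: (rmorph_phi_seq iota r n).
suff [h1 h2] : cont_on_Zp abs (phi_p abs r) /\
    forall n : nat, phi_p abs r n%:R = ratr (phin r n).
  by split=> // n; rewrite h2.
apply: (epsilon_spec (inhabits (fun=> 0 : K)) (fun f =>
  cont_on_Zp abs f /\ forall n : nat, f n%:R = ratr (phin r n))).
have [f [f1 f2]] := phi_seq_interpolation p_pr abs_p abs_ratr inZp_ratrV.
by exists f; split=> // n; rewrite f2.
Qed.

(** This is [Sop_functional] at [y = m / r], where [y + 1/r - 1 = (m+1)/r - 1]. *)
Lemma Phi_p_rec m : Phi_p abs r (m.+1%:R / ratr r - 1) =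
  1 + m%:R / ratr r * Phi_p abs r (m%:R / ratr r - 1).
Proof.
have [h1 h2] := phi_p_spec.
have hy : inZp abs (m%:R / ratr r).
  by apply: (inZpM p_pr abs_p); [exact: (inZp_nat abs_p)|exact: inZp_ratrV].
have -> : m.+1%:R / ratr r - 1 = m%:R / ratr r + (ratr r)^-1 - 1 :> K.
  by rewrite -natr1 mulrDl mul1r.
rewrite /Phi_p; have := Sop_functional p_pr abs_p abs_ratr inZp_ratrV h1 h2 hy.
set A := Sop _ _ (_ + _ - 1) _ => h.
by rewrite [X in X + _]h; ring.
Qed.

Lemma ratr_neq0 : ratr r != 0 :> K.
Proof. by rewrite -(abs_eq0 abs_p) abs_ratr oner_eq0. Qed.

(** Multiplication by [r^m] turns [Phi_p_rec] into the recurrence defining [incgamma_poly]. *)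
Lemma Phi_p_nat m : ratr r ^+ m * Phi_p abs r (m.+1%:R / ratr r - 1) =
  incgamma_poly m (ratr r : K).
Proof.
elim: m => [|m IH]; rewrite Phi_p_rec.
  (* The factor [0 / r] removes the unknown value [Phi(-1)], so the recurrence supplies its own
     initial value. *)
  by rewrite !mul0r addr0 mulr1.
rewrite mulrDr mulr1 [incgamma_poly _ _]/= -IH; congr (_ + _).
by rewrite exprSr; have := ratr_neq0; move: (ratr r) => x x0; field.
Qed.

Lemma Psi_p_nat m :
  Psi_p p abs r m%:R = brk p abs (ratr r) ^+ m * Phi_p abs r (m.+1%:R / ratr r - 1).
Proof. by rewrite /Psi_p (kpow_nat p_pr abs_p) natr1. Qed.

End PhiValues.

(** * Comparison of the places *)

Lemma rmorph_incgamma (F K : fieldType) (h : {rmorphism F -> K}) m (x : F) :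
  h (incgamma_poly m x) = incgamma_poly m (h x).
Proof.
elim: m => [|m IH] /=; first exact: rmorph1.
by rewrite rmorphD rmorphM rmorph_nat rmorphXn IH.
Qed.

(** At [p] the powers of [<r>] cancel, leaving [Phi] at [(m+1)/r - 1], to which [Phi_p_nat] applies;
    at infinity the integral is the polynomial itself. *)
Lemma npsi_incgamma (r : rat) (v : option nat) m : r != 0 -> good_place r v ->
  npsi_is r v m (incgamma_poly m r / r ^+ m).
Proof.
case: v => [p|] r0 /= => [[p_pr vpr] K R abs abs_p|_ R].
  have char0 := char0_padic p_pr abs_p.
  have hb := brk_neq0 p_pr abs_p (inZp_ratr p_pr abs_p r0 vpr) (abs_ratr p_pr abs_p r0 vpr).
  rewrite Psi_p_nat // mulKf ?expf_neq0 //.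
  rewrite -[RHS]/(ratr_char0 char0 _) fmorph_div rmorphXn rmorph_incgamma /=.
  rewrite -(Phi_p_nat p_pr abs_p r0 vpr) [RHS]mulrAC divff ?mul1r // expf_neq0 //.
  exact: (ratr_neq0 p_pr abs_p).
rewrite Psi_infE -EFinM; congr (_%:E).
by rewrite fmorph_div rmorphXn rmorph_incgamma mulrC.
Qed.

(** When [p - 1] divides [m], [<r>^m = r^m] is exactly the factor that [Phi_p_nat] asks for; at
    infinity [ell] is 1 and the divisibility is automatic. *)
Lemma psi_incgamma (r : rat) (v : option nat) m : r != 0 -> good_place r v ->
  (ell v %| m)%N -> psi_is r v m (incgamma_poly m r).
Proof.
case: v => [p|] r0 /= => [[p_pr vpr] pm K R abs abs_p|_ _ R].
  have char0 := char0_padic p_pr abs_p.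
  rewrite Psi_p_nat // (brkX p_pr abs_p) //; last 2 first.
  - exact: (inZp_ratr p_pr abs_p).
  - exact: (abs_ratr p_pr abs_p).
  rewrite (Phi_p_nat p_pr abs_p r0 vpr).
  by rewrite -[RHS]/(ratr_char0 char0 _) rmorph_incgamma.
by rewrite Psi_infE rmorph_incgamma.
Qed.

Theorem theorem9p4 (r : rat) (hr : r != 0) (v w : option nat)
  (hv : good_place r v) (hw : good_place r w) :
  (forall m : nat, exists q : rat, npsi_is r v m q /\ npsi_is r w m q) /\
  (forall m : nat, (lcmn (ell v) (ell w) %| m)%N ->
     exists q : rat, psi_is r v m q /\ psi_is r w m q).
Proof.
split=> [m|m]; first by exists (incgamma_poly m r / r ^+ m); split; exact: npsi_incgamma.
rewrite dvdn_lcm => /andP[vm wm].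
by exists (incgamma_poly m r); split; exact: psi_incgamma.
Qed.
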